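(* Let $n\ge 45$ be an integer and let $D=(d_1,\dots,d_n)$ be a sequence of non-negative integers such that $\sum_{i=1}^n d_i$ is divisible by $3$ and, for every $i=1,\dots,n$, $$\frac{2\left\lfloor\frac{n}{3}\right\rfloor^2}{7}+4\left\lceil\frac{n}{5}\right\rceil+1\ \le\ d_i\ \le\ \frac{5\left\lfloor\frac{n}{3}\right\rfloor^2}{7}.$$ Then $D$ is graphic, i.e. there is a $3$-uniform hypergraph on $n$ vertices whose degree sequence is $D$.
   Context: A $3$-uniform hypergraph $H=(V,E)$ consists of a finite vertex set $V$ and a set $E$ of $3$-element subsets of $V$ (the hyperedges; no hyperedge is repeated). A hyperedge $e$ is incident with a vertex $v$ if $v\in e$. The degree of a vertex is the number of hyperedges incident with it, and the degree sequence of $H$ is the sequence of the degrees of its vertices. A sequence $D=(d_1,\dots,d_n)$ of non-negative integers is graphic (as a $3$-uniform hypergraph degree sequence) if there is a $3$-uniform hypergraph on vertices $v_1,\dots,v_n$, called a realization of $D$, in which $v_i$ has degree $d_i$ for every $i$. *)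

(* Defs.v *)
From mathcomp Require Import all_boot all_order all_algebra.

Set Implicit Arguments.
Unset Strict Implicit.
Unset Printing Implicit Defensive.

(* A hypergraph on the finite vertex set V is given by its set of hyperedges,
   E : {set {set V}}; being a set, it has no repeated hyperedge. *)

Definition uniform3 (V : finType) (E : {set {set V}}) : Prop :=
  {in E, forall e : {set V}, #|e| = 3}.

Definition hdegree (V : finType) (E : {set {set V}}) (v : V) : nat :=
  #|[set e in E | v \in e]|.

Definition realization (n : nat) (D : n.-tuple nat) (E : {set {set 'I_n}}) :
    Prop :=
  uniform3 E /\ (forall i : 'I_n, hdegree E i = tnth D i).

Definition graphic (n : nat) (D : n.-tuple nat) : Prop :=
  exists E : {set {set 'I_n}}, realization D E.

(* Main.v *)
(** Replacing [v] by [u] in a suitable edge moves one unit of degree from [v] to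
    [u] whenever [deg u < deg v]; hence degree sequences are closed downwards
    under majorization.  Write [3 N] for the degree sum, [U] for the largest
    admissible degree and [k = 3 N / U].  The lower bound on the degrees forces
    [N <= 'C(k, 3)], so [N] edges fit inside the [k] vertices of largest
    prescribed degree.  Moves inside this set raise all its degrees to at least
    [U], while the degrees outside stay [0].  That sequence majorizes the
    prescribed one, and further moves lead to it. *)
Require Import Defs.
From mathcomp Require Import all_boot all_order all_algebra.
From mathcomp Require Import perm zify lra.
Set Implicit Arguments.
Unset Strict Implicit.
Unset Printing Implicit Defensive.
Import Order.TTheory GRing.Theory Num.Theory.
Local Open Scope ring_scope.

Section Exchange.
Local Open Scope nat_scope.
Variable V : finType.
Implicit Types (E : {set {set V}}) (K : {set V}) (u v w : V).

Lemma hdegree_sum E v : hdegree E v = \sum_(e in E) (v \in e).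
Proof.
rewrite /hdegree -sum1_card big_mkcond [RHS]big_mkcond /=.
by apply: eq_bigr => e _; rewrite inE; case: (e \in E); case: (v \in e).
Qed.

Lemma sum_hdegree E : uniform3 E -> \sum_v hdegree E v = 3 * #|E|.
Proof.
move=> E3; under eq_bigr do rewrite hdegree_sum.
rewrite exchange_big /= mulnC -sum_nat_const; apply: eq_bigr => e eE.
by rewrite -(E3 _ eE) -sum1_card [RHS]big_mkcond.
Qed.

(** Otherwise [tperm u v] would send every edge through [v] to an edge through [u], edges containing
    both being fixed, and injectivity would give [hdegree E v <= hdegree E u]. *)
Lemma hdegree_gt_swap E u v : hdegree E u < hdegree E v ->
  exists2 e, e \in E & [/\ v \in e, u \notin e & tperm u v @: e \notin E].
Proof.
have swap_inj : injective (fun e : {set V} => tperm u v @: e).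
  exact/imset_inj/perm_inj.
have [/exists_inP [e eE /and3P] | ] :=
    boolP [exists e in E, [&& v \in e, u \notin e & tperm u v @: e \notin E]].
  by exists e.
rewrite negb_exists_in => /forall_inP noswap; rewrite ltnNge => /negP [].
rewrite /hdegree -(card_imset _ swap_inj) subset_leq_card //.
apply/subsetP => _ /imsetP [e /[!inE] /andP [eE ve] ->].
have -> : u \in tperm u v @: e by apply/imsetP; exists v; rewrite ?tpermR.
rewrite andbT; have := noswap _ eE; rewrite ve /=.
case ue: (u \in e); last by rewrite negbK.
suff -> : tperm u v @: e = e by [].
apply/eqP; rewrite eqEcard card_imset ?leqnn ?andbT; last exact: perm_inj.
by apply/subsetP => _ /imsetP [x xe ->]; case: tpermP => // ->.
Qed.

(** The edge found above is replaced by its swapped image. The degree change is written additively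
    to avoid truncated subtraction. *)
Lemma exchange E u v : uniform3 E -> hdegree E u < hdegree E v ->
  exists E' : {set {set V}}, [/\ uniform3 E', #|E'| = #|E| &
    forall w, hdegree E' w + (w == v) = hdegree E w + (w == u)].
Proof.
move=> E3 /hdegree_gt_swap [e eE [ve ue fE]]; set f := _ @: e in fE.
have fE' : f \notin E :\ e by rewrite inE (negPf fE) andbF.
exists (f |: E :\ e); split.
- move=> g /setU1P [->|/setD1P [_ /E3 //]].
  by rewrite card_imset ?E3 //; apply: perm_inj.
- by rewrite cardsU1 fE' (cardsD1 e E) eE.
move=> w; rewrite !hdegree_sum big_setU1 //= (big_setD1 e eE) /=.
have -> : (w \in f) = (tperm u v w \in e).
  by rewrite -{1}[w](tpermK u v) mem_imset //; apply: perm_inj.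
have uv : u != v by apply: contraNneq ue => ->.
case: tpermP => [->|->|/eqP/negPf-> /eqP/negPf->]; last lia.
- by rewrite ve (negPf ue) eqxx (negPf uv); lia.
- by rewrite ve (negPf ue) eqxx eq_sym (negPf uv); lia.
Qed.

(* The comparability hypothesis says that every vertex above its target has a
   larger target, hence a larger degree, than every vertex below its target, so
   [exchange] applies to such pairs until no vertex is below its target. *)
Lemma reach_targets E (T : V -> nat) :
    uniform3 E -> \sum_v T v <= 3 * #|E| ->
    (forall u v, hdegree E u < T u -> T v < hdegree E v -> T u <= T v) ->
  exists E' : {set {set V}}, [/\ uniform3 E', #|E'| = #|E|,
    forall v, T v <= hdegree E' v &
    forall v, hdegree E v <= T v -> hdegree E' v <= T v].
Proof.
(* Induction on the total deficit; truncated subtraction makes vertices above their target count as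
   [0]. *)
have [d] := ubnP (\sum_v (T v - hdegree E v)).
elim: d E => // d IHd E lt_d E3 leT cmpT.
have [/forallP geT | /forallPn [u]] := boolP [forall v, T v <= hdegree E v].
  by exists E.
rewrite -ltnNge => du.
(* Otherwise the strict deficit at [u] would push the degree sum [3 * #|E|] below the sum of the
   targets. *)
have [v dv] : exists v, T v < hdegree E v.
  apply/existsP; apply: contraLR leT; rewrite negb_exists -ltnNge.
  move=> /forallP ledT; rewrite -sum_hdegree //.
  rewrite (bigD1 u) //= [X in _ < X](bigD1 u) //= -addSn leq_add //.
  by apply: leq_sum => w _; rewrite leqNgt.
have lt_uv : hdegree E u < hdegree E v.
  by have := cmpT _ _ du dv; lia.
have [E' [E'3 cE' dE']] := exchange E3 lt_uv.
have uv : u != v by apply: contraTneq lt_uv => ->; rewrite ltnn.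
have dE'u : hdegree E' u = (hdegree E u).+1.
  by have := dE' u; rewrite eqxx (negPf uv); lia.
have dE'v : (hdegree E' v).+1 = hdegree E v.
  by have := dE' v; rewrite eqxx eq_sym (negPf uv); lia.
have dE'w w : w != u -> w != v -> hdegree E' w = hdegree E w.
  by move=> /negPf wu /negPf wv; have := dE' w; rewrite wu wv; lia.
have [||x y|E'' [E''3 cE'' geT keepT]] := IHd E' _ E'3.
- rewrite ltnS in lt_d; apply: leq_trans lt_d.
  rewrite (bigD1 u) //= [X in _ < X](bigD1 u) //= -addSn leq_add //; first lia.
  apply: leq_sum => w wu; have [->|wv] := eqVneq w v; first lia.
  by rewrite dE'w.
- by rewrite cE'.
(* The exchange puts no new vertex below or above its target: [u] was below and gains one, [v] was
   above and loses one. *)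
- move=> dx dy; apply: cmpT.
  + have [->//|xu] := eqVneq x u; have [xv|xv] := eqVneq x v.
      by move: dx; rewrite xv; lia.
    by rewrite -dE'w.
  + have [yu|yu] := eqVneq y u; first by move: dy; rewrite yu; lia.
    have [->//|yv] := eqVneq y v.
    by rewrite -dE'w.
exists E''; split => // [|w dw]; first by rewrite cE''.
apply: keepT; move: dw; have [->|wu] := eqVneq w u; first lia.
have [->|wv] := eqVneq w v; first lia.
by rewrite dE'w.
Qed.

Lemma exists_top_set (f : V -> nat) k : k <= #|V| ->
  exists2 K : {set V}, #|K| = k &
    forall u v, u \notin K -> v \in K -> f u <= f v.
Proof.
elim: k => [_|k IHk ltkV].
  by exists set0 => [|u v]; rewrite ?cards0 // !inE.
have [K cK topK] := IHk (ltnW ltkV).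
have /card_gt0P [x0 x0K] : 0 < #|~: K| by rewrite cardsCs setCK cK subn_gt0.
rewrite inE in x0K.
have [x xK maxx] := @arg_maxnP _ _ (fun x => x \notin K) f x0K.
exists (x |: K) => [|u v]; first by rewrite cardsU1 xK cK.
rewrite !inE negb_or => /andP [_ uK] /predU1P [->|]; last exact: topK.
exact: maxx.
Qed.

Lemma exists_subset_card (T : finType) (A : {set T}) m : m <= #|A| ->
  exists2 B : {set T}, B \subset A & #|B| = m.
Proof.
move=> leA; have /card_gt0P [B] :
    0 < #|[set B : {set T} | B \subset A & #|B| == m]|.
  by rewrite cards_draws bin_gt0.
by rewrite inE => /andP [BA /eqP cB]; exists B.
Qed.

Lemma realizable_of_clique (D : V -> nat) (N U k : nat) :
    \sum_v D v = 3 * N -> (forall v, D v <= U) ->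
    k <= #|V| -> k * U <= 3 * N -> N <= 'C(k, 3) ->
  exists E : {set {set V}}, uniform3 E /\ forall v, hdegree E v = D v.
Proof.
move=> sumD leDU lekV lekU leN; have [K cK topK] := exists_top_set D lekV.
have [|E0 subE0 cE0] := @exists_subset_card _
  [set e : {set V} | e \subset K & #|e| == 3] N.
  by rewrite cards_draws cK.
have E0K e : e \in E0 -> e \subset K /\ #|e| = 3.
  by move=> /(subsetP subE0); rewrite inE => /andP [? /eqP].
have dE0 v : v \notin K -> hdegree E0 v = 0.
  move=> vK; rewrite hdegree_sum big1 // => e /E0K [/subsetP eK _].
  by rewrite (contraNF (eK v)).
have [|||E1 [E13 cE1 geU leU]] :=
    @reach_targets E0 (fun v => if v \in K then U else 0).
- by move=> e /E0K [].
- by rewrite -big_mkcond sum_nat_const cK cE0.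
(* Vertices outside [K] have degree [0], so a vertex above its target lies in [K], where the target
   is the maximal value [U]. *)
- move=> u v; case: (u \in K) => //.
  by case: ifPn => // /dE0 ->.
have [|u v|E [E3 cE geD _]] := @reach_targets E1 D E13.
- by rewrite sumD cE1 cE0.
(* Degrees on [K] are at least [U] and degrees off [K] are still [0], so a vertex below its target
   is outside [K] and one above it is inside. *)
- move=> du dv; apply: topK.
    apply: contraTN du => uK; rewrite -leqNgt (leq_trans (leDU u)) //.
    by have := geU u; rewrite uK.
  apply: contraTT dv => vK; have := leU v; rewrite (negPf vK) dE0 // => /(_ isT).
  by rewrite leqn0 => /eqP ->.
(* All degrees dominate [D] and the totals agree, so equality holds everywhere. *)
exists E; split=> // v; apply/eqP; rewrite eqn_leq geD andbT leqNgt.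
apply/negP => ltv; suff : \sum_v D v < \sum_v hdegree E v.
  by rewrite sum_hdegree // cE cE1 cE0 sumD ltnn.
rewrite (bigD1 v) //= [X in _ < X](bigD1 v) //= -addSn leq_add //.
exact: leq_sum.
Qed.

End Exchange.

Section Arithmetic.
Local Open Scope nat_scope.

(** The hypotheses give [6 N < (k + 1) (k - 2)^2], which is at most [k (k - 1) (k - 2)]. *)
Lemma bin3_ge (k U N : nat) : 2 <= k -> 3 * N < k.+1 * U ->
  2 * U <= (k - 2) ^ 2 -> N <= 'C(k, 3).
Proof.
case: k => [|[|k]] // _ ltN; rewrite subSS subSS subn0 -mulnn => leU.
have binE := bin_ffact k.+2 3; rewrite !ffactnS ffactn0 /= muln1 in binE.
have le_kU : k.+3 * (2 * U) <= k.+3 * (k * k) by rewrite leq_mul2l leU orbT.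
rewrite -(leq_pmul2r (fact_gt0 3)) binE (_ : 3`! = 6) //; nia.
Qed.

(** The last hypothesis is the lower degree bound multiplied by [35] and summed over the [n]
    vertices. *)
Lemma clique_size_bound (n m N U : nat) :
  0 < m -> 3 * m <= n -> 7 * U <= 5 * m ^ 2 -> 0 < U ->
  n * (10 * m ^ 2 + 28 * n + 35) <= 105 * N ->
  6 * m + 45 <= 5 * (3 * N %/ U).
Proof.
move=> m0 le_mn leU U0 leN; set k := _ %/ U.
have ltN : 3 * N < k.+1 * U by rewrite -ltn_divLR.
have leN3 : 3 * m * (10 * m ^ 2 + 28 * (3 * m) + 35) <= 105 * N.
  by apply: leq_trans leN; apply: leq_mul => //; lia.
have leUk : k.+1 * (7 * U) <= k.+1 * (5 * m ^ 2) by rewrite leq_mul2l leU orbT.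
(* Here [105 * N = 35 * (3 * N) < 35 * k.+1 * U <= 25 * k.+1 * m ^ 2]; the factor [m] is set apart
   for cancellation. *)
have ltmk : 3 * m * (10 * m ^ 2 + 28 * (3 * m) + 35) < m * (25 * k.+1 * m).
  by rewrite -mulnn in leN3 leUk *; nia.
have {}ltmk : 3 * (10 * m ^ 2 + 28 * (3 * m) + 35) < 25 * k.+1 * m.
  by move: ltmk; rewrite [3 * m]mulnC -mulnA ltn_mul2l => /andP [].
have : m * (30 * m + 252) < m * (25 * k.+1) by rewrite -mulnn in ltmk; nia.
rewrite ltn_mul2l => /andP [_]; lia.
Qed.

End Arithmetic.

Lemma floor_divn (R : archiRealFieldType) (n d : nat) :
  (0 < d)%N -> Num.floor (n%:R / d%:R : R) = (n %/ d)%N.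
Proof.
move=> d0; apply: floor_def; rewrite -[_ + 1]/((n %/ d)%:Z + 1%:Z) -PoszD addn1 !pmulrn.
rewrite ler_pdivlMr ?ltr_pdivrMr ?ltr0n // -!natrM ler_nat ltr_nat.
by rewrite leq_trunc_div ltn_ceil.
Qed.

Theorem theorem4p1 (n : nat) (D : n.-tuple nat)
    (hn : (45 <= n)%N)
    (hdvd : (3 %| \sum_(i < n) tnth D i)%N)
    (hD : forall i : 'I_n,
      2 * (Num.floor (n%:R / 3 : rat))%:~R ^+ 2 / 7
        + 4 * (Num.ceil (n%:R / 5 : rat))%:~R + 1
      <= (tnth D i)%:R :> rat
      /\ (tnth D i)%:R
      <= 5 * (Num.floor (n%:R / 3 : rat))%:~R ^+ 2 / 7 :> rat) :
  graphic D.
Proof.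
set m := (n %/ 3)%N.
(* Denominators are cleared by [35] and [7]; the ceiling is only bounded below by [n / 5]. *)
have hD' i : (10 * m ^ 2 + 28 * n + 35 <= 35 * tnth D i)%N /\
    (7 * tnth D i <= 5 * m ^ 2)%N.
  have [] := hD i; rewrite floor_divn // -pmulrn -/m => lo hi.
  have ce : n%:R / 5 <= (Num.ceil (n%:R / 5 : rat))%:~R :> rat.
    exact: ceil_ge.
  split; rewrite -(ler_nat rat) ?natrD !natrM -?expr2; lra.
pose U := (5 * m ^ 2 %/ 7)%N.
have m15 : (15 <= m)%N by rewrite leq_divRL.
have le_mn : (3 * m <= n)%N by rewrite mulnC leq_trunc_div.
have leDU i : (tnth D i <= U)%N by rewrite leq_divRL // mulnC; case: (hD' i).
have U0 : (0 < U)%N by rewrite leq_divRL //; rewrite -mulnn; nia.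
have leU : (7 * U <= 5 * m ^ 2)%N by rewrite mulnC leq_trunc_div.
have /dvdnP [N sumD] := hdvd; rewrite mulnC in sumD.
have leN : (n * (10 * m ^ 2 + 28 * n + 35) <= 105 * N)%N.
  rewrite (_ : 105 = 35 * 3)%N // -mulnA -sumD big_distrr /=.
  rewrite -[X in (X * _)%N]card_ord -sum_nat_const.
  by apply: leq_sum => i _; case: (hD' i).
pose k := (3 * N %/ U)%N.
have kge : (6 * m + 45 <= 5 * k)%N.
  by apply: (@clique_size_bound n) => //; apply: leq_trans m15.
apply: (@realizable_of_clique _ (tnth D) N U k) => //.
(* [k * U <= 3 * N <= n * U], the degrees being at most [U]. *)
- rewrite card_ord -(leq_pmul2r U0); apply: leq_trans (leq_trunc_div _ _) _.
  rewrite -sumD -[X in (_ <= X * _)%N]card_ord -sum_nat_const.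
  exact: leq_sum.
- exact: leq_trunc_div.
apply: (@bin3_ge _ U); first lia.
  by rewrite -ltn_divLR.
(* Since [36 / 25 > 10 / 7], [k - 2 >= 6 m / 5] yields [(k - 2)^2 >= 10 m^2 / 7 >= 2 U]. *)
have : (6 * m + 35 <= 5 * (k - 2))%N by lia.
rewrite -!mulnn in leU *; nia.
Qed.
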